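(* Fix $\zeta,\psi_2\in(0,\infty)$ and $\rho\in(0,\infty)$. Then the function $\bar\lambda\mapsto\mathscr R_{\mathrm{wide}}(\rho,\zeta,\psi_2,\bar\lambda)$ on $[0,\infty)$ is either strictly increasing in $\bar\lambda$, or strictly decreasing first and then strictly increasing. Moreover, $$\rho>\rho_\star(\zeta,\psi_2)\ \Rightarrow\ \arg\min_{\bar\lambda\ge0}\mathscr R_{\mathrm{wide}}(\rho,\zeta,\psi_2,\bar\lambda)=0,$$ $$\rho<\rho_\star(\zeta,\psi_2)\ \Rightarrow\ \arg\min_{\bar\lambda\ge0}\mathscr R_{\mathrm{wide}}(\rho,\zeta,\psi_2,\bar\lambda)=\bar\lambda_\star(\zeta,\psi_2,\rho)>0.$$
   Context: For $\zeta,\psi_2\in(0,\infty)$ and $\bar\lambda\ge0$ let $$\omega=\omega(\bar\lambda,\zeta,\psi_2)=-\frac{[(\psi_2\zeta^2-\zeta^2-\bar\lambda\psi_2-1)^2+4\psi_2\zeta^2(\bar\lambda\psi_2+1)]^{1/2}+(\psi_2\zeta^2-\zeta^2-\bar\lambda\psi_2-1)}{2(\bar\lambda\psi_2+1)},$$ $$\mathscr B_{\mathrm{wide}}(\zeta,\psi_2,\bar\lambda)=\frac{\psi_2\omega-\psi_2}{(\psi_2-1)\omega^3+(1-3\psi_2)\omega^2+3\psi_2\omega-\psi_2},\quad \mathscr V_{\mathrm{wide}}(\zeta,\psi_2,\bar\lambda)=\frac{\omega^3-\omega^2}{(\psi_2-1)\omega^3+(1-3\psi_2)\omega^2+3\psi_2\omega-\psi_2},$$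 $$\mathscr R_{\mathrm{wide}}(\rho,\zeta,\psi_2,\bar\lambda)=\frac{\rho}{1+\rho}\mathscr B_{\mathrm{wide}}(\zeta,\psi_2,\bar\lambda)+\frac1{1+\rho}\mathscr V_{\mathrm{wide}}(\zeta,\psi_2,\bar\lambda).$$ Further let $$\omega_0(\zeta,\psi_2)=-\frac{[(\psi_2\zeta^2-\zeta^2-1)^2+4\psi_2\zeta^2]^{1/2}+(\psi_2\zeta^2-\zeta^2-1)}2,\qquad \rho_\star(\zeta,\psi_2)=\frac{\omega_0^2-\omega_0}{(1-\psi_2)\omega_0+\psi_2},$$ $$\omega_1(\rho,\psi_2)=-\frac{(\psi_2\rho-\rho-1)+[(\psi_2\rho-\rho-1)^2+4\psi_2\rho]^{1/2}}2,\qquad \bar\lambda_\star(\zeta,\psi_2,\rho)=\frac{\zeta^2\psi_2-\zeta^2\omega_1\psi_2+\zeta^2\omega_1+\omega_1-\omega_1^2}{(\omega_1^2-\omega_1)\psi_2}.$$ *)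

(* Defs.v *)
From mathcomp Require Import all_boot all_order all_algebra.
From mathcomp Require Import classical_sets reals.

Set Implicit Arguments.
Unset Strict Implicit.
Unset Printing Implicit Defensive.

Import Order.TTheory GRing.Theory Num.Theory.
Local Open Scope ring_scope.

Section RandomFeaturesWide.
Variable R : realType.

Definition omega (lambda zeta psi2 : R) : R :=
  let a := psi2 * zeta ^+ 2 - zeta ^+ 2 - lambda * psi2 - 1 in
  - (Num.sqrt (a ^+ 2 + 4 * psi2 * zeta ^+ 2 * (lambda * psi2 + 1)) + a)
  / (2 * (lambda * psi2 + 1)).

(* The denominator is (w - 1) * (psi2 * (w - 1) ^+ 2 - w ^+ 2); it does not
   vanish at w = omega lambda zeta psi2 for zeta, psi2 > 0 and lambda >= 0. *)
Definition wide_denom (psi2 w : R) : R :=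
  (psi2 - 1) * w ^+ 3 + (1 - 3 * psi2) * w ^+ 2 + 3 * psi2 * w - psi2.

Definition B_wide (zeta psi2 lambda : R) : R :=
  let w := omega lambda zeta psi2 in
  (psi2 * w - psi2) / wide_denom psi2 w.

Definition V_wide (zeta psi2 lambda : R) : R :=
  let w := omega lambda zeta psi2 in
  (w ^+ 3 - w ^+ 2) / wide_denom psi2 w.

Definition R_wide (rho zeta psi2 lambda : R) : R :=
  rho / (1 + rho) * B_wide zeta psi2 lambda
  + 1 / (1 + rho) * V_wide zeta psi2 lambda.

Definition omega0 (zeta psi2 : R) : R :=
  let a := psi2 * zeta ^+ 2 - zeta ^+ 2 - 1 in
  - (Num.sqrt (a ^+ 2 + 4 * psi2 * zeta ^+ 2) + a) / 2.

Definition rho_star (zeta psi2 : R) : R :=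
  let w := omega0 zeta psi2 in
  (w ^+ 2 - w) / ((1 - psi2) * w + psi2).

Definition omega1 (rho psi2 : R) : R :=
  let a := psi2 * rho - rho - 1 in
  - (a + Num.sqrt (a ^+ 2 + 4 * psi2 * rho)) / 2.

Definition lambda_star (zeta psi2 rho : R) : R :=
  let w := omega1 rho psi2 in
  (zeta ^+ 2 * psi2 - zeta ^+ 2 * w * psi2 + zeta ^+ 2 * w + w - w ^+ 2)
  / ((w ^+ 2 - w) * psi2).

Definition argmin_on (A : set R) (f : R -> R) : set R :=
  [set x | A x /\ forall y, A y -> f x <= f y]%classic.

Definition strictly_increasing_on (i : interval R) (f : R -> R) : Prop :=
  {in i &, {homo f : x y / x < y}}.

Definition strictly_decreasing_on (i : interval R) (f : R -> R) : Prop :=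
  {in i &, {homo f : x y /~ x < y}}.

End RandomFeaturesWide.

(* Main.v *)
Require Import Defs.
From mathcomp Require Import all_boot all_order all_algebra.
From mathcomp Require Import classical_sets reals.
From mathcomp Require Import ring lra.

Import Order.TTheory GRing.Theory Num.Theory.
Local Open Scope ring_scope.

(** Put [p = psi2], [z = zeta ^+ 2], [c = lambda * p + 1] and [u = - omega].
    By the quadratic formula [u] is the positive root of
    [c * u * (1 + u) = z * (p * (1 + u) - u)], that is, of
    [c / z = p / u - 1 / (1 + u)]; the product form shows [p * (1 + u) > u],
    a region on which the right-hand side decreases, so [u] decreases as
    [lambda] grows ([omega_strictly_increasing]).

    In terms of [u] the common factor [1 + u] cancels from numerators and
    denominator, and [(1 + rho) * risk] becomes
    [(rho * p + u ^+ 2) / (p * (1 + u) ^+ 2 - u ^+ 2)], whose derivative has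
    the sign of [g u = u * (1 + u) - rho * (p * (1 + u) - u)].  The equation
    for [u] turns this into the sign of [z - rho * c].  So, as [lambda]
    grows, the risk strictly decreases while [rho * (lambda * p + 1) <= z]
    ([risk_decreasing]) and strictly increases once
    [z <= rho * (lambda * p + 1)] ([risk_increasing]).  No derivative is
    taken: the difference quotient is, up to a positive factor, the
    polarization of the quadratic [g] ([reduced_risk_sub]).

    Finally, the quadratic equations of [omega0] and [omega1] collapse the
    thresholds of the statement: [rho_star = z], and
    [lambda_star = (z / rho - 1) / p] is the solution of
    [rho * (lambda * p + 1) = z]. *)

(** * The quadratic equation satisfied by omega *)

Lemma negative_root_spec (R : rcfType) (a b c : R) : 0 < b -> 0 < c ->
  let w := - (Num.sqrt (a ^+ 2 + 4 * b * c) + a) / (2 * c) in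
  w < 0 /\ c * w ^+ 2 + a * w = b.
Proof.
move=> b_gt0 c_gt0 /=.
have bc_gt0 : 0 < b * c by rewrite mulr_gt0.
have a2_ge0 := sqr_ge0 a.
set s := Num.sqrt _.
have s_ge0 : 0 <= s by rewrite sqrtr_ge0.
have s2E : s ^+ 2 = a ^+ 2 + 4 * b * c by rewrite sqr_sqrtr //; lra.
have c_neq0 : c != 0 by rewrite gt_eqF.
split.
  have sa_gt0 : 0 < s + a.
    rewrite ltNge; apply/negP => sa_le0.
    have : 0 <= (- a - s) * (- a + s) by apply: mulr_ge0; lra.
    lra.
  by rewrite mulNr oppr_lt0 divr_gt0 // mulr_gt0.
have -> : b = (s ^+ 2 - a ^+ 2) / (4 * c) by rewrite s2E; field.
by field.
Qed.

(** For [w < 0] the left-hand side is positive, so the right-hand factor, which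
    is the denominator of [rho_star], may be cancelled. *)
Lemma factor_gt0 (R : realFieldType) (c k p w : R) : 0 < c -> 0 < k -> w < 0 ->
  c * (w ^+ 2 - w) = k * ((1 - p) * w + p) -> 0 < (1 - p) * w + p.
Proof.
move=> c_gt0 k_gt0 w_lt0 E.
rewrite -(pmulr_rgt0 _ k_gt0) -E mulr_gt0 //.
have := sqr_ge0 w; lra.
Qed.

Lemma omega_spec (R : realType) (zeta psi2 lambda : R) :
  0 < zeta -> 0 < psi2 -> 0 <= lambda ->
  let w := omega lambda zeta psi2 in
  w < 0 /\
  (lambda * psi2 + 1) * (w ^+ 2 - w) = zeta ^+ 2 * ((1 - psi2) * w + psi2).
Proof.
move=> zeta_gt0 psi2_gt0 lambda_ge0 /=.
have c_gt0 : 0 < lambda * psi2 + 1.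
  by have := mulr_ge0 lambda_ge0 (ltW psi2_gt0); lra.
have b_gt0 : 0 < psi2 * zeta ^+ 2 by rewrite mulr_gt0 ?exprn_gt0.
have /= [] := negative_root_spec R
  (psi2 * zeta ^+ 2 - zeta ^+ 2 - lambda * psi2 - 1) _ _ b_gt0 c_gt0.
rewrite /omega [4 * (_ * _)]mulrA; set w := _ / _ => w_lt0 E; split=> //.
lra.
Qed.

Lemma omega0_spec (R : realType) (zeta psi2 : R) : 0 < zeta -> 0 < psi2 ->
  let w := omega0 zeta psi2 in
  w < 0 /\ w ^+ 2 - w = zeta ^+ 2 * ((1 - psi2) * w + psi2).
Proof.
move=> zeta_gt0 psi2_gt0.
have := omega_spec R zeta psi2 0 zeta_gt0 psi2_gt0 (lexx 0).
by rewrite /omega /omega0 !mul0r add0r subr0 !mulr1 mul1r.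
Qed.

Lemma omega1_spec (R : realType) (rho psi2 : R) : 0 < rho -> 0 < psi2 ->
  let w := omega1 rho psi2 in
  w < 0 /\ w ^+ 2 - w = rho * ((1 - psi2) * w + psi2).
Proof.
move=> rho_gt0 psi2_gt0 /=.
have /= [] := negative_root_spec R (psi2 * rho - rho - 1) _ _
  (mulr_gt0 psi2_gt0 rho_gt0) ltr01.
rewrite /omega1 !mulr1 !mul1r [4 * (_ * _)]mulrA [X in - X / 2]addrC.
set w := _ / 2 => w_lt0 E; split=> //.
lra.
Qed.

(** * The thresholds in closed form *)

Lemma rho_starE (R : realType) (zeta psi2 : R) : 0 < zeta -> 0 < psi2 ->
  rho_star zeta psi2 = zeta ^+ 2.
Proof.
move=> zeta_gt0 psi2_gt0; rewrite /rho_star.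
have /= [w_lt0 E] := omega0_spec R zeta psi2 zeta_gt0 psi2_gt0.
have z_gt0 : 0 < zeta ^+ 2 by rewrite exprn_gt0.
rewrite E mulfK // gt_eqF // (factor_gt0 R 1 (zeta ^+ 2)) //.
by rewrite mul1r.
Qed.

Lemma lambda_starE (R : realType) (zeta psi2 rho : R) :
  0 < psi2 -> 0 < rho ->
  lambda_star zeta psi2 rho = (zeta ^+ 2 / rho - 1) / psi2.
Proof.
move=> psi2_gt0 rho_gt0; rewrite /lambda_star.
have /= [w_lt0 E] := omega1_spec R rho psi2 rho_gt0 psi2_gt0.
set w := omega1 rho psi2 in w_lt0 E *.
have k_gt0 : 0 < (1 - psi2) * w + psi2.
  by apply: (factor_gt0 R 1 rho) => //; rewrite mul1r.
set k := (1 - psi2) * w + psi2 in E k_gt0.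
have -> : zeta ^+ 2 * psi2 - zeta ^+ 2 * w * psi2 + zeta ^+ 2 * w + w - w ^+ 2
          = zeta ^+ 2 * k - (w ^+ 2 - w) by rewrite /k; ring.
rewrite E; field.
by rewrite !gt_eqF.
Qed.

(** * The risk as a function of u = - omega *)

(** For a quadratic [q] with [q 0 < 0] and nonnegative leading coefficient,
    [q u / u] increases on the positive axis, so [q] changes sign only once
    there.  With [q u = c * (u ^+ 2 + u) - z * (p * (1 + u) - u)], raising [c]
    makes [q] positive at its old root, and the new root lies to the left. *)
Lemma omega_strictly_increasing (R : realType) (zeta psi2 l m : R) :
  0 < zeta -> 0 < psi2 -> 0 <= l -> l < m ->
  omega l zeta psi2 < omega m zeta psi2.
Proof.
move=> zeta_gt0 p_gt0 l_ge0 lt_lm.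
have m_ge0 : 0 <= m by lra.
have /= [v_lt0 Ev] := omega_spec R zeta psi2 l zeta_gt0 p_gt0 l_ge0.
have /= [w_lt0 Ew] := omega_spec R zeta psi2 m zeta_gt0 p_gt0 m_ge0.
set v := omega l _ _ in v_lt0 Ev *; set w := omega m _ _ in w_lt0 Ew *.
rewrite ltNge; apply/negP => le_wv.
have z_gt0 : 0 < zeta ^+ 2 by rewrite exprn_gt0.
set z := zeta ^+ 2 in Ev Ew z_gt0.
have vw_gt0 : 0 < v * w by rewrite nmulr_rgt0.
have c_gt0 : 0 < m * psi2 + 1 by have := mulr_ge0 m_ge0 (ltW p_gt0); lra.
(* [v * w] times the increment of [q u / u] from [- v] to [- w]. *)
have slope_ge0 : 0 <= (v - w) * ((m * psi2 + 1) * (v * w) + z * psi2).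
  apply: mulr_ge0; first by rewrite subr_ge0.
  by apply: addr_ge0; apply/ltW/mulr_gt0.
(* The gain of [q] at [- v] caused by raising [c], weighted by [- w]. *)
have gain_gt0 : 0 < (- w) * ((m - l) * psi2 * (v ^+ 2 - v)).
  apply: mulr_gt0; first by rewrite oppr_gt0.
  apply: mulr_gt0; first by rewrite mulr_gt0 // subr_gt0.
  by have := sqr_ge0 v; lra.
have Ev' : w * ((l * psi2 + 1) * (v ^+ 2 - v))
         = w * (z * ((1 - psi2) * v + psi2)) by rewrite Ev.
have Ew' : v * ((m * psi2 + 1) * (w ^+ 2 - w))
         = v * (z * ((1 - psi2) * w + psi2)) by rewrite Ew.
lra.
Qed.

(** The quadratic is the denominator left after cancelling [1 + u]; the
    equation bounds [u] through [u < p * (1 + u)]. *)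
Lemma wide_quadratic_gt0 (R : realFieldType) (c z p u : R) :
  0 < c -> 0 < z -> 0 < u ->
  c * (u ^+ 2 + u) = z * (p * (1 + u) - u) ->
  0 < p * (1 + u) ^+ 2 - u ^+ 2.
Proof.
move=> c_gt0 z_gt0 u_gt0 E.
have : 0 < p * (1 + u) - u.
  by rewrite -(pmulr_rgt0 _ z_gt0) -E mulr_gt0 // addr_gt0 // exprn_gt0.
have -> : p * (1 + u) ^+ 2 - u ^+ 2 = (p * (1 + u) - u) * (1 + u) + u by ring.
by move=> k_gt0; rewrite addr_gt0 // mulr_gt0 // addr_gt0.
Qed.

(** [(1 + rho) * risk] in terms of [u], after cancelling [1 + u]. *)
Definition reduced_risk {R : realType} (rho p u : R) : R :=
  (rho * p + u ^+ 2) / (p * (1 + u) ^+ 2 - u ^+ 2).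

Lemma R_wideE (R : realType) (rho zeta psi2 l : R) :
  0 < zeta -> 0 < psi2 -> 0 < rho -> 0 <= l ->
  R_wide rho zeta psi2 l
  = reduced_risk rho psi2 (- omega l zeta psi2) / (1 + rho).
Proof.
move=> zeta_gt0 p_gt0 rho_gt0 l_ge0.
have /= [w_lt0 E] := omega_spec R zeta psi2 l zeta_gt0 p_gt0 l_ge0.
rewrite /R_wide /B_wide /V_wide /reduced_risk.
set w := omega l _ _ in w_lt0 E *.
have D_gt0 : 0 < psi2 * (1 + - w) ^+ 2 - (- w) ^+ 2.
  apply: (wide_quadratic_gt0 R (l * psi2 + 1) (zeta ^+ 2)).
  - by have := mulr_ge0 l_ge0 (ltW p_gt0); lra.
  - by rewrite exprn_gt0.
  - by rewrite oppr_gt0.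
  - by rewrite sqrrN E; ring.
have -> : wide_denom psi2 w
    = (w - 1) * (psi2 * (1 + - w) ^+ 2 - (- w) ^+ 2).
  by rewrite /wide_denom; ring.
set D := _ - (- w) ^+ 2 in D_gt0 *.
have w1_neq0 : w - 1 != 0 by rewrite lt_eqF // subr_lt0 (lt_trans w_lt0).
have rho1_neq0 : 1 + rho != 0 by rewrite gt_eqF // addr_gt0.
field.
by rewrite (gt_eqF D_gt0) w1_neq0 rho1_neq0.
Qed.

(** The bracket is twice the polarization at [(x, y)] of the quadratic [g]
    which governs the sign of the derivative; at [x = y] it is [2 * g x]. *)
Lemma reduced_risk_sub (R : realType) (rho p x y : R) :
  0 < p * (1 + x) ^+ 2 - x ^+ 2 -> 0 < p * (1 + y) ^+ 2 - y ^+ 2 ->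
  reduced_risk rho p y - reduced_risk rho p x
  = p * (y - x) / ((p * (1 + x) ^+ 2 - x ^+ 2) * (p * (1 + y) ^+ 2 - y ^+ 2))
    * (x + y + 2 * (x * y) - rho * (p * (2 + x + y) - (x + y))).
Proof.
move=> Dx Dy; rewrite /reduced_risk; field.
by rewrite !gt_eqF.
Qed.

(** At fixed [y] the polarization of [g] is affine in [x]: it is [g y <= 0] at
    [x = y], and at [x = 0] it is [(g 0 + g y - y ^+ 2) / 2], which is negative
    since [g 0 = - rho * p < 0]. *)
Lemma reduced_risk_decreasing (R : realType) (rho p x y : R) :
  0 < rho -> 0 < p ->
  0 < p * (1 + x) ^+ 2 - x ^+ 2 -> 0 < p * (1 + y) ^+ 2 - y ^+ 2 ->
  0 < x -> x < y -> y ^+ 2 + y <= rho * (p * (1 + y) - y) ->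
  reduced_risk rho p y < reduced_risk rho p x.
Proof.
move=> rho_gt0 p_gt0 Dx Dy x_gt0 lt_xy gy_le0.
rewrite -subr_lt0 reduced_risk_sub // pmulr_rlt0; last first.
  by rewrite divr_gt0 ?mulr_gt0 // subr_gt0.
have y_gt0 : 0 < y by lra.
rewrite -(pmulr_rlt0 _ y_gt0).
have h1 : 0 <= (x + y) * (rho * (p * (1 + y) - y) - (y ^+ 2 + y)).
  by apply: mulr_ge0; lra.
have h2 : 0 < (y - x) * (rho * p + y ^+ 2).
  by rewrite mulr_gt0 ?subr_gt0 // addr_gt0 ?exprn_gt0 // mulr_gt0.
lra.
Qed.

(** Mirror image of the previous lemma: the polarization of [g] is affine in
    [y], with value [g x] at [y = x] and slope [g' x / 2]; the convex [g] has
    [g 0 < 0 <= g x], which forces [0 < g' x]. *)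
Lemma reduced_risk_increasing (R : realType) (rho p x y : R) :
  0 < rho -> 0 < p ->
  0 < p * (1 + x) ^+ 2 - x ^+ 2 -> 0 < p * (1 + y) ^+ 2 - y ^+ 2 ->
  0 < x -> x < y -> rho * (p * (1 + x) - x) <= x ^+ 2 + x ->
  reduced_risk rho p x < reduced_risk rho p y.
Proof.
move=> rho_gt0 p_gt0 Dx Dy x_gt0 lt_xy gx_ge0.
rewrite -subr_gt0 reduced_risk_sub // pmulr_rgt0; last first.
  by rewrite divr_gt0 ?mulr_gt0 // subr_gt0.
rewrite -(pmulr_rgt0 _ x_gt0).
have h1 : 0 <= (x + y) * (x ^+ 2 + x - rho * (p * (1 + x) - x)).
  by apply: mulr_ge0; lra.
have h2 : 0 < (y - x) * (rho * p + x ^+ 2).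
  by rewrite mulr_gt0 ?subr_gt0 // addr_gt0 ?exprn_gt0 // mulr_gt0.
lra.
Qed.

(** * Monotonicity of the risk in the regularization *)

(** Along the curve [u = - omega lambda], the equation for [omega] gives
    [z * g u = (z - rho * c) * u * (1 + u)] with [c = lambda * psi2 + 1]. *)
Lemma omega_opp_spec (R : realType) (zeta psi2 l : R) :
  0 < zeta -> 0 < psi2 -> 0 <= l ->
  let u := - omega l zeta psi2 in
  [/\ 0 < u, 0 < psi2 * (1 + u) ^+ 2 - u ^+ 2 &
   forall rho, zeta ^+ 2 * (u ^+ 2 + u - rho * (psi2 * (1 + u) - u))
    = (zeta ^+ 2 - rho * (l * psi2 + 1)) * (u ^+ 2 + u)].
Proof.
move=> zeta_gt0 p_gt0 l_ge0 u.
have /= [w_lt0 E] := omega_spec R zeta psi2 l zeta_gt0 p_gt0 l_ge0.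
have u_gt0 : 0 < u by rewrite /u oppr_gt0.
have Eu : (l * psi2 + 1) * (u ^+ 2 + u) = zeta ^+ 2 * (psi2 * (1 + u) - u).
  by rewrite /u sqrrN E; ring.
split=> //.
  apply: (wide_quadratic_gt0 R (l * psi2 + 1) (zeta ^+ 2)) => //.
    by have := mulr_ge0 l_ge0 (ltW p_gt0); lra.
  by rewrite exprn_gt0.
by move=> rho; rewrite mulrBl -!mulrA Eu; ring.
Qed.

Lemma risk_increasing (R : realType) (rho zeta psi2 l m : R) :
  0 < zeta -> 0 < psi2 -> 0 < rho -> 0 <= l -> l < m ->
  zeta ^+ 2 <= rho * (l * psi2 + 1) ->
  R_wide rho zeta psi2 l < R_wide rho zeta psi2 m.
Proof.
move=> zeta_gt0 p_gt0 rho_gt0 l_ge0 lt_lm z_le.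
have m_ge0 : 0 <= m by lra.
rewrite !R_wideE // ltr_pM2r ?invr_gt0 ?addr_gt0 //.
have /= [u_gt0 Du Eu] := omega_opp_spec R zeta psi2 l zeta_gt0 p_gt0 l_ge0.
have /= [v_gt0 Dv _] := omega_opp_spec R zeta psi2 m zeta_gt0 p_gt0 m_ge0.
apply: reduced_risk_decreasing => //.
  by rewrite ltrN2; apply: omega_strictly_increasing.
have z_gt0 : 0 < zeta ^+ 2 by rewrite exprn_gt0.
rewrite -subr_le0 -(pmulr_rle0 _ z_gt0) Eu.
by rewrite pmulr_lle0 ?subr_le0 // addr_gt0 // exprn_gt0.
Qed.

Lemma risk_decreasing (R : realType) (rho zeta psi2 l m : R) :
  0 < zeta -> 0 < psi2 -> 0 < rho -> 0 <= l -> l < m ->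
  rho * (m * psi2 + 1) <= zeta ^+ 2 ->
  R_wide rho zeta psi2 m < R_wide rho zeta psi2 l.
Proof.
move=> zeta_gt0 p_gt0 rho_gt0 l_ge0 lt_lm z_ge.
have m_ge0 : 0 <= m by lra.
rewrite !R_wideE // ltr_pM2r ?invr_gt0 ?addr_gt0 //.
have /= [u_gt0 Du _] := omega_opp_spec R zeta psi2 l zeta_gt0 p_gt0 l_ge0.
have /= [v_gt0 Dv Ev] := omega_opp_spec R zeta psi2 m zeta_gt0 p_gt0 m_ge0.
apply: reduced_risk_increasing => //.
  by rewrite ltrN2; apply: omega_strictly_increasing.
have z_gt0 : 0 < zeta ^+ 2 by rewrite exprn_gt0.
rewrite -subr_ge0 -(pmulr_rge0 _ z_gt0) Ev.
by rewrite pmulr_lge0 ?subr_ge0 // addr_gt0 // exprn_gt0.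
Qed.

Lemma argmin_on_unique (R : realType) (A : set R) (f : R -> R) (x : R) :
  A x -> (forall y, A y -> y != x -> f x < f y) ->
  argmin_on A f = [set x]%classic.
Proof.
move=> Ax f_gt; apply/seteqP; split=> [y [Ay y_min]|_ ->] /=.
  apply/eqP; case: (eqVneq y x) => // y_neq_x.
  by have := f_gt y Ay y_neq_x; rewrite ltNge y_min.
split=> // y Ay; case: (eqVneq y x) => [-> //|y_neq_x].
exact/ltW/f_gt.
Qed.

Theorem proposition5p2 (R : realType) (rho zeta psi2 : R)
    (zeta_gt0 : 0 < zeta) (psi2_gt0 : 0 < psi2) (rho_gt0 : 0 < rho) :
  let risk := R_wide rho zeta psi2 in
  [/\ strictly_increasing_on `[0, +oo[ risk \/
      (exists2 l : R, 0 < l &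
         strictly_decreasing_on `[0, l] risk /\
         strictly_increasing_on `[l, +oo[ risk),
      rho_star zeta psi2 < rho ->
        argmin_on [set l | 0 <= l]%classic risk = [set 0]%classic
    & rho < rho_star zeta psi2 ->
        argmin_on [set l | 0 <= l]%classic risk
          = [set lambda_star zeta psi2 rho]%classic
        /\ 0 < lambda_star zeta psi2 rho].
Proof.
move=> risk; rewrite rho_starE // lambda_starE //.
set ls := (zeta ^+ 2 / rho - 1) / psi2.
have lsE : rho * (ls * psi2 + 1) = zeta ^+ 2.
  by rewrite /ls; field; rewrite !gt_eqF.
have c_homo l m : l <= m -> rho * (l * psi2 + 1) <= rho * (m * psi2 + 1).
  by move=> le_lm; rewrite ler_pM2l // lerD2r ler_pM2r.
have incr0 : zeta ^+ 2 <= rho -> forall l m, 0 <= l -> l < m -> risk l < risk m.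
  move=> z_le l m l_ge0 lt_lm; apply: risk_increasing => //.
  by apply: le_trans (c_homo 0 l l_ge0); rewrite mul0r add0r mulr1.
have ls_gt0 : rho < zeta ^+ 2 -> 0 < ls.
  by move=> lt_rz; rewrite divr_gt0 // subr_gt0 ltr_pdivlMr // mul1r.
have decr l m : 0 <= l -> l < m -> m <= ls -> risk m < risk l.
  move=> l_ge0 lt_lm le_m; apply: risk_decreasing => //.
  by rewrite -lsE; apply: c_homo.
have incr l m : 0 <= l -> ls <= l -> l < m -> risk l < risk m.
  move=> l_ge0 le_l lt_lm; apply: risk_increasing => //.
  by rewrite -lsE; apply: c_homo.
split.
- case: (leP (zeta ^+ 2) rho) => [z_le|lt_rz].
    left=> l m; rewrite !in_itv /= !andbT => l_ge0 _.
    exact: incr0.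
  right; exists ls; first exact: ls_gt0.
  have ls_ge0 := ltW (ls_gt0 lt_rz).
  split=> l m; rewrite !in_itv /=.
    by move=> /andP[_ l_le] /andP[m_ge0 _] lt_ml; apply: decr.
  rewrite !andbT => le_l _; apply: incr => //.
  exact: le_trans le_l.
- move=> lt_zr; apply: argmin_on_unique => [|y y_ge0 y_neq0] /=.
    exact: lexx.
  by apply: incr0; rewrite ?(ltW lt_zr) // lt_neqAle eq_sym y_neq0.
- move=> lt_rz; split; last exact: ls_gt0.
  have ls_ge0 := ltW (ls_gt0 lt_rz).
  apply: argmin_on_unique => // y y_ge0 /=.
  rewrite neq_lt => /orP[lt_y|lt_y]; first exact: decr.
  exact: incr.
Qed.
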